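(* Let $A:\ell^2\to Y$ be an injective bounded linear operator into the infinite dimensional Banach space $Y$, with adjoint $A^*:Y^*\to\ell^2$ and with range not closed in $Y$. Let $y\in{\rm Range}(A)$ be such that the unique solution $x^\dagger$ of $Ax=y$ lies in $\ell^0$ and has non-empty finite support $I=\{i\in\mathbb N:x^\dagger_i\neq0\}$. Assume that for every $i\in\mathbb N$ there exists $\omega_i\in Y^*$ with $e^{(i)}=A^*\omega_i$. Let $1<q<\infty$ and, for $\eta,\alpha,\delta>0$ and $y^\delta\in Y$ with $\|y-y^\delta\|\le\delta$, let $x_{\alpha,\eta}^\delta$ be a minimizer over $x\in\ell^2$ of $$\frac1q\|Ax-y^\delta\|^q+\alpha\Big(\|x\|_{\ell^0}+\frac{\eta}{2}\|x\|_{\ell^2}^2\Big).$$ Fix a sufficiently large bound $\rho>0$ and set $\mathcal M:=\{x\in\ell^0:\|x\|_{\ell^2}\le\rho\}$. With $$K:=\sum_{i\in I}\|\omega_i\|_{Y^*},\qquad \underline\kappa:=\min_{i\in I}|x_i^\dagger|,\qquad c_0(\eta):=K\left(\frac1\rho+\frac1{\underline\kappa}+\eta\|x^\dagger\|_{\ell^\infty}\right),$$ for all triples $(\eta,\alpha,\delta)$ of positive real numbers with $x_{\alpha,\eta}^\delta\in\mathcal M$ there holds the error estimate $$\|x_{\alpha,\eta}^\delta-x^\dagger\|_{\ell^1}\le\rho\left[\frac{\delta^q}{q\alpha}+c_0(\eta)\,\delta+(c_0(\eta))^{\frac q{q-1}}\alpha^{\frac1{q-1}}\right].$$ For the standard a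 priori parameter choice $\alpha_*=\alpha(\delta):=\delta^{q-1}$, the error estimate $$\|x_{\alpha_*,\eta}^\delta-x^\dagger\|_{\ell^1}\le C\,\delta\quad\text{with}\quad C=\rho\left[\frac1q+c_0(\eta)+(c_0(\eta))^{\frac q{q-1}}\right]$$ holds true for $\eta>0$ and $\rho>0$ satisfying $$\rho>\sqrt{\frac2\eta\|x^\dagger\|_{\ell^0}+\|x^\dagger\|_{\ell^2}^2}$$ and for sufficiently small $\delta>0$.
   Context: $\ell^0$ is the set of real sequences with finitely many nonzero components. For a sequence $x$, $\|x\|_{\ell^0}=\sum_{i=1}^\infty \operatorname{sgn}(|x_i|)$ is the number of its nonzero components ($+\infty$ if $x\notin\ell^0$). $e^{(i)}$ is the $i$-th standard unit sequence in $\ell^2$. $\|\cdot\|$ is the norm of $Y$, and $Y^*$ is the dual of $Y$. The dual of $\ell^2$ is identified with $\ell^2$, so that $\langle A^*w,x\rangle=\langle w,Ax\rangle_{Y^*\times Y}$. *)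

(* Defs.v *)
From HB Require Import structures.
From mathcomp Require Import all_boot all_order all_algebra.
From mathcomp Require Import finmap all_classical all_reals all_analysis.
Set Implicit Arguments.
Unset Strict Implicit.
Unset Printing Implicit Defensive.
Import Order.TTheory GRing.Theory Num.Theory.
Import numFieldNormedType.Exports.
Local Open Scope classical_set_scope.
Local Open Scope ring_scope.

Section SequenceSpaces.
Context {R : realType}.
Implicit Type x : nat -> R.

(* Sequences are indexed from 0. The norms below take values in [0, +oo]. *)
Definition lnorm (p : \bar R) x : \bar R :=
  'N[@counting nat R]_p[EFin \o x]%E.

Definition l0norm x : \bar R := (\sum_(0 <= i <oo) (Num.sg `|x i|)%:E)%E.

Definition supp x : set nat := [set i | x i != 0].

Definition ell0 : set (nat -> R) := [set x | finite_set (supp x)].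

End SequenceSpaces.

(* Only the empty set is negligible for the counting measure, so l^2 consists
   of genuine functions: no quotient by equality almost everywhere is needed. *)
Definition ell2 (R : realType) : Type :=
  LfunType (@counting nat R) (lee1n 2 : (1 <= 2%:R%:E)%E).

Section Ell2.
Context {R : realType}.
Implicit Types x y : ell2 R.

HB.instance Definition _ := GRing.Lmodule.on (ell2 R).

Definition ell2_norm x : R := fine (lnorm 2%:E x).

Lemma ler_ell2_normD x y : ell2_norm (x + y) <= ell2_norm x + ell2_norm y.
Proof. exact: ler_LnormD. Qed.

Lemma ell2_normZ (a : R) x : ell2_norm (a *: x) = `|a| * ell2_norm x.
Proof.
rewrite /ell2_norm /lnorm.
have -> : EFin \o (a *: x) = EFin \o (a \*: (x : nat -> R)) by [].
by rewrite LnormZ -finite_norm_fine.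
Qed.

Lemma ell2_norm_eq0 x : ell2_norm x = 0 -> x = 0.
Proof.
move=> x0; apply/LfuneqP => i.
have [A [_ A0 sA]] := fine_Lnormr_eq0 x0.
apply: contrapT => xi0.
have {sA xi0}Ai : A i by apply: sA => /= /(_ I).
move: A0; rewrite /= /counting; case: ifPn => [/asboolP finA|//].
move=> /eqP; rewrite eqe pnatr_eq0 cardfs_eq0 => /eqP A0.
have : i \in fset_set A by rewrite in_fset_set// inE.
by rewrite A0.
Qed.

HB.instance Definition _ := @Lmodule_isNormed.Build R (ell2 R)
  ell2_norm ler_ell2_normD ell2_normZ ell2_norm_eq0.

Definition ell2_dot x y : R := limn (series (fun i => x i * y i)).

Lemma unit_seq_Lfun i :
  (fun j => (j == i)%:R : R) \in Lfun (@counting nat R) 2%:E.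
Proof.
apply/andP; split; rewrite inE//=.
rewrite /finite_norm Lnorm_counting// poweR_lty//.
rewrite (nneseries_split 0 i.+1); last by move=> k _; exact: poweR_ge0.
rewrite add0n ereal_series_cond eseries0 ?adde0; last first.
  by move=> k _ /andP[ik _]; rewrite /= gt_eqF// normr0 powR0.
rewrite lte_sum_pinfty// => k _.
by rewrite /= ltry.
Qed.

Definition unit_seq i : ell2 R := Lfun_Sub _ (unit_seq_Lfun i).

Definition level_set (rho : R) : set (ell2 R) :=
  [set x : ell2 R | ell0 (x : nat -> R) /\ `|x| <= rho].

End Ell2.

Section Dual.
Context {R : realType}.

Record dual (Y : normedModType R) := Dual {
  dual_fun :> {linear Y -> R^o};
  dual_continuous : continuous dual_fun }.

Definition dual_norm (Y : normedModType R) (w : dual Y) : R :=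
  sup [set `|w v| | v in [set v | `|v| <= 1]].

Definition finite_dimensional (Y : lmodType R) : Prop :=
  exists (n : nat) (b : 'I_n -> Y),
    forall v, exists c : 'I_n -> R, v = \sum_(i < n) c i *: b i.

(* This identity determines As; the dual of l^2 is identified with l^2. *)
Definition is_adjoint (Y : normedModType R) (A : {linear ell2 R -> Y})
    (As : dual Y -> ell2 R) : Prop :=
  forall (w : dual Y) (x : ell2 R), ell2_dot (As w) x = w (A x).

End Dual.

Section Tikhonov.
Context {R : realType} {Y : normedModType R}.
Variable A : {linear ell2 R -> Y}.

Definition tikhonov (q alpha eta : R) (yd : Y) (x : ell2 R) : \bar R :=
  ((q^-1 * `|A x - yd| `^ q)%:E
   + alpha%:E * (l0norm x + (eta / 2 * `|x| ^+ 2)%:E))%E.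

Definition is_minimizer (q alpha eta : R) (yd : Y) (x : ell2 R) : Prop :=
  forall z : ell2 R, (tikhonov q alpha eta yd x <= tikhonov q alpha eta yd z)%E.

End Tikhonov.

Section Constants.
Context {R : realType} {Y : normedModType R}.
Variables (omega : nat -> dual Y) (xdag : ell2 R).

Definition K_const : R := \sum_(i \in supp xdag) dual_norm (omega i).

(* The infimum is a minimum when the support is finite and non-empty. *)
Definition kappa_const : R := inf [set `|xdag i| | i in supp xdag].

Definition c0_const (rho eta : R) : R :=
  K_const * (rho^-1 + kappa_const^-1 + eta * fine (lnorm +oo%E xdag)).

End Constants.

(* Main.v *)
Require Import Defs.
From HB Require Import structures.
From mathcomp Require Import all_boot all_order all_algebra.
From mathcomp Require Import lra ring.
From mathcomp Require Import all_classical all_reals all_analysis ess_sup_inf.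
Set Implicit Arguments.
Unset Strict Implicit.
Unset Printing Implicit Defensive.
Import Order.TTheory GRing.Theory Num.Theory.
Import numFieldNormedType.Exports.
Local Open Scope classical_set_scope.
Local Open Scope ring_scope.

(** The penalty R(x) = |x|_0 + eta/2 |x|_2^2 is a sum over coordinates, and so
is the l^1 distance to xdag; this reduces the whole estimate to one variable.
Let |x|_2 <= rho, so that every |x_i| <= rho.

Off the support I of xdag, a nonzero x_i costs 1 in R, hence at least
|x_i| / rho ([vi_off_support]). On I, annihilating a coordinate gains 1 in R
but moves it by |xdag_i| >= kappa, so that the gain is at most
|x_i - xdag_i| / kappa, while convexity bounds the gain in the quadratic term
by eta |xdag|_oo |x_i - xdag_i| ([vi_on_support]). The coordinates of I are
controlled by the residual: from e^(i) = A^* omega_i one gets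
x_i - xdag_i = omega_i (A (x - xdag)), hence
|x_i - xdag_i| <= |omega_i| |A x - A xdag| ([coord_le_dual]). Summing up gives
the variational inequality ([variational_inequality])
<<
  |x - xdag|_1 / rho <= R(x) - R(xdag) + c0 |A x - A xdag|
>>
for x in the level set. With t = |A x - yd|, comparing the Tikhonov values
of a minimizer and of xdag yields ([minimizer_bound])
<<
  R(x) - R(xdag) <= (delta^q - t^q) / (q alpha),
>>
and |A x - A xdag| <= t + delta. The remaining term c0 t is absorbed into
t^q / (q alpha) by Young's inequality ([young_weighted]), which leaves the
power c0^(q/(q-1)) alpha^(1/(q-1)) ([error_estimate]).

For alpha = delta^(q-1) the three terms are all linear in delta. It is then
enough to know that minimizers lie in the level set: minimality gives
eta/2 |x|_2^2 <= delta/q + R(xdag), and for small delta the right-hand side is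
below eta/2 rho^2 by the strict lower bound on rho ([minimizer_level_set]).

All sequences involved have finite support, because a finite penalty forces
it ([l0norm_fin_ell0]); hence all norms are finite sums over a common range. *)

(** * Norms of finitely supported sequences *)

Section FiniteSupport.
Context {R : realType}.
Implicit Types (x u : nat -> R) (N : nat).

Lemma ell0_bounded_supp x :
  ell0 x -> exists N, forall i, (N <= i)%N -> x i = 0.
Proof.
move=> /finite_seqP[s sE]; exists (\max_(i <- s) i).+1 => i si.
apply/eqP; apply: contraLR si => xi0; rewrite -ltnNge ltnS.
have is_ : i \in s by have : supp x i by []; rewrite sE.
exact: leq_bigmax_seq.
Qed.

Lemma eseries_ord u N : (forall i, (N <= i)%N -> u i = 0) ->
  (\sum_(0 <= i <oo) (u i)%:E = (\sum_(i < N) u i)%:E)%E.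
Proof.
move=> u0; apply: lim_near_cst => //.
exists N => // n /= Nn; rewrite sumEFin -(big_mkord xpredT u).
rewrite (@big_cat_nat _ _ _ N)//= [X in _ + X]big_nat_cond.
by rewrite [X in _ + X]big1 ?addr0// => i /andP[/andP[/u0]].
Qed.

Lemma lnorm1_ord x N : (forall i, (N <= i)%N -> x i = 0) ->
  lnorm 1 x = (\sum_(i < N) `|x i|)%:E.
Proof.
move=> x0; rewrite /lnorm Lnorm1 ge0_integral_count//.
by rewrite (@eseries_ord (fun i => `|x i|) N)// => i /x0 ->; rewrite normr0.
Qed.

Lemma l0norm_ord x N : (forall i, (N <= i)%N -> x i = 0) ->
  l0norm x = (\sum_(i < N) Num.sg `|x i|)%:E.
Proof.
by move=> x0; apply: eseries_ord => i /x0 ->; rewrite normr0 sgr0.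
Qed.

Lemma ell2_norm_ord (x : ell2 R) N : (forall i, (N <= i)%N -> x i = 0) ->
  `|x| ^+ 2 = \sum_(i < N) x i ^+ 2.
Proof.
move=> x0; rewrite [`|x|]/(ell2_norm x) /ell2_norm /lnorm Lnorm_counting//.
under eq_eseriesr => k _.
  rewrite /= powR_mulrn// real_normK ?num_real//; over.
rewrite (@eseries_ord (fun i => x i ^+ 2) N); last first.
  by move=> i /x0 ->; rewrite expr0n.
rewrite poweR_EFin/= -powR_mulrn ?powR_ge0// -powRrM mulVf ?powRr1//.
by apply: sumr_ge0 => i _; exact: sqr_ge0.
Qed.

(** Points have counting measure 1, so the only negligible set is empty; this
makes the essential supremum a genuine supremum. *)
Lemma counting_aeP (P : set nat) :
  (\forall i \ae @counting nat R, P i) -> forall i, P i.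
Proof.
move=> [B [_ B0 PB]] i; apply: contrapT => Pi.
have Bi : B i by exact: PB.
have : (1 <= @counting nat R B)%E; last by rewrite B0 lee_fin ler10.
rewrite counting_dirac.
apply: le_trans (nneseries_lim_ge i.+1 (fun k _ _ => measure_ge0 _ _)).
rewrite big_nat_recr//= diracE mem_set// leeDr//.
by apply: sume_ge0 => k _; exact: measure_ge0.
Qed.

Lemma le_lnormy x i : ell0 x -> `|x i| <= fine (lnorm +oo%E x).
Proof.
move=> /ell0_bounded_supp[N x0].
rewrite /lnorm unlock; case: ifPn => [_|]; last first.
  (* The uniform norm is 0 by convention on a null space, but the whole space
     is not negligible. *)
  rewrite -leNgt => n0.
  have /= := @counting_aeP (fun=> False) _ i; apply: contraPP => _; apply.
  exists setT; split => //; apply/eqP; rewrite eq_le n0/=.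
  exact: measure_ge0.
have x_le := counting_aeP (ess_sup_ge (@counting nat R) (abse \o (EFin \o x))).
rewrite -lee_fin fineK; first exact: x_le i.
rewrite fin_numElt; apply/andP; split.
  apply: (@lt_le_trans _ _ `|x i|%:E) => //; first by rewrite ltNyr.
  exact: x_le i.
apply: (@le_lt_trans _ _ (\sum_(j < N) `|x j|)%:E); last by rewrite ltry.
apply/ess_supP; apply: nearW => j /=; rewrite lee_fin.
have [jN|/x0 ->] := ltnP j N; last by rewrite normr0 sumr_ge0.
by rewrite (bigD1 (Ordinal jN))//= lerDl sumr_ge0.
Qed.

(** The nonzero terms of the series are all 1, so its tails, which tend to 0,
vanish from some index on. *)
Lemma l0norm_fin_ell0 x : (l0norm x < +oo)%E -> ell0 x.
Proof.
move=> xoo.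
have sg0 k : (0 <= (Num.sg `|x k|)%:E)%E by rewrite lee_fin sgr_ge0.
have /fine_cvgP[fN] := nneseries_tail_cvg xoo (fun k _ => sg0 k).
move=> /cvgr_lt/(_ 1 ltr01) lt1.
have [N _ NP] : \forall N \near \oo,
    (\sum_(N <= k <oo) (Num.sg `|x k|)%:E < 1%:E)%E.
  by near=> N; rewrite -[X in (X < _)%E]fineK ?lte_fin; near: N.
apply: (sub_finite_set _ (finite_II N)) => i /= xi0.
rewrite ltnNge; apply/negP => Ni.
have := NP i Ni; apply/negP; rewrite -leNgt.
apply: le_trans (nneseries_lim_ge i.+1 (fun k _ _ => sg0 k)).
by rewrite big_nat1 gtr0_sg// normr_gt0.
Unshelve. all: by end_near. Qed.

End FiniteSupport.

(** * Coordinates controlled by the image under A *)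

Section DualElements.
Context {R : realType}.

(** The real-valued supremum defining the dual norm is meaningful only for a
set that is bounded above: this is where the continuity of w enters. *)
Lemma dual_norm_has_ubound (Y : normedModType R) (w : dual Y) :
  has_ubound [set `|w v| | v in [set v | `|v| <= 1]].
Proof.
have /linear_bounded_continuous/linear_boundedP/pinfty_ex_gt0[r r0 wr] :=
  @dual_continuous R Y w.
exists r => _ [u u1 <-]; apply: le_trans (wr u) _.
by rewrite -[leRHS]mulr1 ler_pM2l.
Qed.

Lemma dual_norm_ge0 (Y : normedModType R) (w : dual Y) : 0 <= dual_norm w.
Proof.
apply: ub_le_sup; first exact: dual_norm_has_ubound.
by exists 0 => /=; rewrite ?linear0 normr0.
Qed.

Lemma le_dual_norm (Y : normedModType R) (w : dual Y) v :
  `|w v| <= dual_norm w * `|v|.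
Proof.
have [->|v0] := eqVneq v 0; first by rewrite linear0 !normr0 mulr0.
have v_gt0 : 0 < `|v| by rewrite normr_gt0.
rewrite -ler_pdivrMr//.
have -> : `|w v| / `|v| = `|w (`|v|^-1 *: v)|.
  by rewrite linearZ/= normrM ger0_norm ?invr_ge0// mulrC.
apply: ub_le_sup; first exact: dual_norm_has_ubound.
by exists (`|v|^-1 *: v) => //=; rewrite normrZ normfV normr_id mulVf ?gt_eqF.
Qed.

Lemma ell2_dot_unit_seq i (x : ell2 R) : ell2_dot (unit_seq i) x = x i.
Proof.
apply: lim_near_cst => //; exists i.+1 => // n /= ni.
rewrite /series/= big_mkord (bigD1 (Ordinal ni))//= eqxx mul1r big1 ?addr0//.
by move=> j ji; rewrite (_ : (j == i :> nat) = false) ?mul0r//; apply/negbTE.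
Qed.

(** Source condition: the i-th coordinate of x is <e^(i), x> = <w, A x>. *)
Lemma coord_le_dual (Y : normedModType R) (A : {linear ell2 R -> Y}) As
    (w : dual Y) i (x : ell2 R) : is_adjoint A As -> unit_seq i = As w ->
  `|x i| <= dual_norm w * `|A x|.
Proof.
move=> hAs e; rewrite -(ell2_dot_unit_seq i x) e hAs; exact: le_dual_norm.
Qed.

End DualElements.

(** * The variational inequality for a single coordinate *)

Section VariationalInequality.
Context {R : realType}.

(** A coordinate of size at most rho pays its length in units of rho through
the counting term, which is 1 as soon as the coordinate is nonzero. *)
Lemma vi_off_support (eta rho b : R) : 0 < eta -> 0 < rho -> `|b| <= rho ->
  `|b| / rho <= Num.sg `|b| + eta / 2 * b ^+ 2.
Proof.
move=> e0 r0 br.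
have : 0 <= eta / 2 * b ^+ 2 by rewrite mulr_ge0 ?sqr_ge0// divr_ge0 ?ltW.
have : `|b| / rho <= Num.sg `|b|; last by move=> ? ?; lra.
have [->|b0] := eqVneq b 0; first by rewrite normr0 mul0r sgr0.
by rewrite gtr0_sg ?normr_gt0// ler_pdivrMr// mul1r.
Qed.

(** The factor of |b - a| on the right has one summand for each effect: 1/rho
is the left-hand side itself, 1/kappa pays for the loss of a nonzero
coordinate, and eta M for the decrease of the quadratic term. *)
Lemma vi_on_support (eta rho kappa M a b : R) : 0 < eta -> 0 < rho ->
  0 < kappa -> kappa <= `|a| -> `|a| <= M ->
  `|b - a| / rho <= Num.sg `|b| - 1 + eta / 2 * (b ^+ 2 - a ^+ 2)
    + (rho^-1 + kappa^-1 + eta * M) * `|b - a|.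
Proof.
move=> e0 r0 k0 ka aM.
(* The counting term is below 1 only when b = 0, and then
   |b - a| = |a| >= kappa. *)
have count : 0 <= Num.sg `|b| - 1 + kappa^-1 * `|b - a|.
  have [->|b0] := eqVneq b 0.
    rewrite normr0 sgr0 !sub0r normrN addrC subr_ge0.
    by rewrite -ler_pdivrMl ?invr_gt0// invrK mulr1.
  by rewrite gtr0_sg ?normr_gt0// subrr add0r mulr_ge0// invr_ge0 ltW.
(* The parabola lies above its tangent at a. *)
have quad : 0 <= eta / 2 * (b ^+ 2 - a ^+ 2) + eta * M * `|b - a|.
  have -> : eta / 2 * (b ^+ 2 - a ^+ 2) =
    eta / 2 * (b - a) ^+ 2 + eta * (a * (b - a)) by field.
  have h1 : 0 <= eta / 2 * (b - a) ^+ 2.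
    by rewrite mulr_ge0 ?sqr_ge0// divr_ge0 ?ltW.
  have h2 : - (M * `|b - a|) <= a * (b - a).
    rewrite lerNl; apply: le_trans (ler_norm _) _.
    by rewrite normrN normrM ler_wpM2r.
  have : eta * - (M * `|b - a|) <= eta * (a * (b - a)) by rewrite ler_pM2l.
  by rewrite mulrN -mulrA; lra.
by rewrite mulrC; lra.
Qed.

End VariationalInequality.

(** * The constants of the estimate *)

Section Kappa.
Context {R : realType}.

(** The infimum over a finite support is bounded below by the minimum m of
finitely many positive numbers; the value 1 only initializes that minimum. *)
Lemma kappa_const_gt0 (xdag : ell2 R) : ell0 (xdag : nat -> R) ->
  supp xdag !=set0 -> 0 < kappa_const xdag.
Proof.
move=> /ell0_bounded_supp[N xdag0] [j xdagj].
pose m := \big[Num.min/1]_(i < N | xdag i != 0) `|xdag i|.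
have m_gt0 : 0 < m by apply: lt_bigmin => // i; rewrite normr_gt0.
apply: lt_le_trans m_gt0 _; apply: lb_le_inf; first by exists `|xdag j|, j.
move=> _ [i xdagi <-].
have iN : (i < N)%N by rewrite ltnNge; apply/negP => /xdag0/eqP; exact/negP.
exact: (@bigmin_le_cond _ _ _ _ (Ordinal iN)).
Qed.

Lemma kappa_const_le (xdag : ell2 R) i :
  xdag i != 0 -> kappa_const xdag <= `|xdag i|.
Proof.
by move=> xi; apply: ge_inf; [exists 0 => _ [k _ <-] | exists i].
Qed.

Lemma K_const_ord (Y : normedModType R) (omega : nat -> dual Y)
    (xdag : ell2 R) N : (forall i, (N <= i)%N -> xdag i = 0) ->
  K_const omega xdag =
  \sum_(i < N) (if xdag i != 0 then dual_norm (omega i) else 0).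
Proof.
move=> xdag0.
rewrite (fsbig_ord _ N
  (fun i => if xdag i != 0 then dual_norm (omega i) else 0)).
rewrite -(@fsbig_widen _ _ _ _ (supp xdag)).
- by apply: eq_fsbigr => i; rewrite inE => /= ->.
- by move=> i /= xi; rewrite ltnNge; apply/negP => /xdag0/eqP; exact/negP.
- by move=> i /= [_ /negP]; case: ifP => // xi; rewrite xi.
Qed.

End Kappa.

(** * Powers *)

(** Young's inequality for the factorization
c t = (c alpha^(1/q)) (t alpha^(-1/q)) with exponents q/(q-1) and q; the
factor (q-1)/q < 1 of the first power is discarded. *)
Lemma young_weighted (R : realType) (q alpha c t : R) :
  1 < q -> 0 < alpha -> 0 <= c -> 0 <= t ->
  c * t <= t `^ q / (q * alpha) + c `^ (q / (q - 1)) * alpha `^ (q - 1)^-1.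
Proof.
move=> q1 a0 c0 t0.
have q0 : 0 < q by exact: lt_trans q1.
have qm0 : 0 < q - 1 by rewrite subr_gt0.
have a0' := ltW a0.
have p0 : 0 < q / (q - 1) by rewrite divr_gt0.
have conj : q^-1 + (q / (q - 1))^-1 = 1 by field; rewrite !gt_eqF.
have := conjugate_powR (mulr_ge0 t0 (powR_ge0 alpha (- q^-1)))
  (mulr_ge0 c0 (powR_ge0 alpha q^-1)) q0 p0 conj.
rewrite !powRM ?powR_ge0// -!powRrM mulNr mulVf ?gt_eqF// powR_inv1//.
have -> : q^-1 * (q / (q - 1)) = (q - 1)^-1 by field; rewrite !gt_eqF.
rewrite powRN.
have -> : t * (alpha `^ q^-1)^-1 * (c * alpha `^ q^-1) = c * t.
  by field; rewrite gt_eqF// powR_gt0.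
move=> /le_trans; apply; apply: lerD; first by rewrite invfM mulrA mulrAC.
rewrite ler_pdivrMr// ler_peMr ?mulr_ge0 ?powR_ge0//.
by rewrite ler_pdivlMr// mul1r; lra.
Qed.

Lemma powR_mulr_pred (R : realType) (d q : R) :
  0 < d -> d `^ q = d `^ (q - 1) * d.
Proof.
move=> d0; rewrite -{3}(powRr1 (ltW d0)) -powRD ?subrK//.
by apply/implyP => _; rewrite gt_eqF.
Qed.

(** * Error estimates for Tikhonov minimizers *)

Section ErrorEstimate.
Context {R : realType} {Y : normedModType R}.
Context (A : {linear ell2 R -> Y}) (As : dual Y -> ell2 R).
Context (omega : nat -> dual Y) (xdag : ell2 R).
Context (hAs : is_adjoint A As).
Context (homega : forall i, unit_seq i = As (omega i)).
Context (xdag0 : ell0 (xdag : nat -> R)) (suppn0 : supp xdag !=set0).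

Definition penalty (eta : R) (x : ell2 R) : R :=
  fine (l0norm x) + eta / 2 * `|x| ^+ 2.

(** Sum of the coordinatewise inequalities; c0 appears because only the
coordinates of the support of xdag use the residual, each one with its factor
|omega_i|. *)
Lemma variational_inequality (eta rho : R) (x : ell2 R) :
  0 < eta -> 0 < rho -> level_set rho x ->
  (lnorm 1 (x - xdag : ell2 R)%R <=
   (rho * (penalty eta x - penalty eta xdag
           + c0_const omega xdag rho eta * `|A x - A xdag|))%:E)%E.
Proof.
move=> e0 r0 [xell0 xrho].
have [N1 x0] := ell0_bounded_supp xell0.
have [N2 xd0] := ell0_bounded_supp xdag0.
pose N := maxn N1 N2.
have {}x0 i : (N <= i)%N -> x i = 0 by rewrite geq_max => /andP[/x0].
have {}xd0 i : (N <= i)%N -> xdag i = 0 by rewrite geq_max => /andP[_ /xd0].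
have sub0 i : (N <= i)%N -> (x - xdag : ell2 R) i = 0.
  by move=> Ni; rewrite [LHS](_ : _ = x i - xdag i)// x0// xd0// subrr.
rewrite (lnorm1_ord sub0) lee_fin -ler_pdivrMl//.
rewrite /penalty (l0norm_ord x0) (l0norm_ord xd0)/=.
rewrite (ell2_norm_ord x0) (ell2_norm_ord xd0) /c0_const (K_const_ord _ xd0).
set c := rho^-1 + _ + _.
set F := fun i : 'I_N => if xdag i != 0 then dual_norm (omega i) else 0.
have -> : \sum_(i < N) Num.sg `|x i| + eta / 2 * \sum_(i < N) x i ^+ 2 -
    (\sum_(i < N) Num.sg `|xdag i| + eta / 2 * \sum_(i < N) xdag i ^+ 2) +
    (\sum_(i < N) F i) * c * `|A x - A xdag| =
  \sum_(i < N) (Num.sg `|x i| + eta / 2 * x i ^+ 2 -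
    (Num.sg `|xdag i| + eta / 2 * xdag i ^+ 2) + F i * c * `|A x - A xdag|).
  by rewrite big_split/= sumrB !big_split/= -!mulr_sumr -!mulr_suml.
rewrite mulr_sumr; apply: ler_sum => i _.
have xi_rho : `|x i| <= rho.
  apply: le_trans xrho.
  rewrite -(@ler_pXn2r _ 2)// ?nnegrE// (ell2_norm_ord x0).
  rewrite real_normK ?num_real//.
  by rewrite (bigD1 i)//= lerDl; apply: sumr_ge0 => k _; exact: sqr_ge0.
rewrite [X in rho^-1 * `|X|](_ : _ = x i - xdag i)// mulrC /F.
have [xi0|xi0] := eqVneq (xdag i) 0.
  rewrite xi0 subr0 normr0 sgr0 expr0n/= mulr0 !addr0 subr0 !mul0r addr0.
  exact: vi_off_support.
have := vi_on_support (x i) e0 r0 (kappa_const_gt0 xdag0 suppn0)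
  (kappa_const_le xi0) (le_lnormy i xdag0).
move=> /le_trans; apply; rewrite -/c.
rewrite [Num.sg `|xdag i|]gtr0_sg ?normr_gt0// mulrBr/=.
suff : c * `|x i - xdag i| <= dual_norm (omega i) * c * `|A x - A xdag| by lra.
have c0 : 0 <= c.
  rewrite !addr_ge0 ?invr_ge0 ?(ltW r0)// ?(ltW (kappa_const_gt0 _ _))//.
  by rewrite mulr_ge0 ?(ltW e0)//; exact: le_trans (le_lnormy i xdag0).
rewrite [_ * c]mulrC -mulrA ler_wpM2l// -linearB.
exact: (@coord_le_dual _ _ A As (omega i) i (x - xdag) hAs (homega i)).
Qed.

(** Comparison with the competitor xdag. Its Tikhonov value is finite, hence so
is that of x, and a finite counting term means finite support. *)
Lemma minimizer_bound (q alpha eta delta : R) (yd : Y) (x : ell2 R) :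
  1 < q -> 0 < alpha -> 0 < delta -> `|A xdag - yd| <= delta ->
  is_minimizer A q alpha eta yd x ->
  ell0 (x : nat -> R) /\
  q^-1 * `|A x - yd| `^ q + alpha * penalty eta x <=
  q^-1 * delta `^ q + alpha * penalty eta xdag.
Proof.
move=> q1 a0 d0 yyd /(_ xdag).
have q0 : 0 < q by exact: lt_trans q1.
have [N xd0] := ell0_bounded_supp xdag0.
have tE (z : ell2 R) : (l0norm z < +oo)%E -> tikhonov A q alpha eta yd z =
    (q^-1 * `|A z - yd| `^ q + alpha * penalty eta z)%:E.
  move=> zoo; rewrite /tikhonov /penalty -[l0norm z]fineK//.
  rewrite ge0_fin_numE//.
  by apply: nneseries_ge0 => k _ _; rewrite lee_fin sgr_ge0.
rewrite (tE xdag) ?(l0norm_ord xd0) ?ltry// => le_t.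
have xoo : (l0norm x < +oo)%E.
  rewrite ltey; apply: contraTN le_t => /eqP xoo.
  rewrite /tikhonov xoo addye// gt0_muley ?lte_fin// addey// leye_eq.
split; first exact: l0norm_fin_ell0.
move: le_t; rewrite (tE x)// lee_fin => /le_trans; apply.
rewrite lerD2r ler_pM2l ?invr_gt0//.
by apply: ge0_ler_powR; rewrite ?nnegrE// ltW.
Qed.

Lemma c0_const_ge0 (eta rho : R) :
  0 < eta -> 0 < rho -> 0 <= c0_const omega xdag rho eta.
Proof.
move=> e0 r0; have [N xd0] := ell0_bounded_supp xdag0.
apply: mulr_ge0.
  rewrite (K_const_ord _ xd0); apply: sumr_ge0 => i _.
  by case: ifP => // _; exact: dual_norm_ge0.
rewrite !addr_ge0 ?invr_ge0 ?(ltW r0)// ?(ltW (kappa_const_gt0 _ _))//.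
by rewrite mulr_ge0 ?(ltW e0)//; exact: le_trans (le_lnormy 0 xdag0).
Qed.

(** In the variational inequality the residual is split at yd; the part c0 t is
then compensated by the term - t^q / (q alpha) that minimality provides. *)
Lemma error_estimate (q eta alpha delta rho : R) (yd : Y) (x : ell2 R) :
  1 < q -> 0 < rho -> 0 < eta -> 0 < alpha -> 0 < delta ->
  `|A xdag - yd| <= delta -> is_minimizer A q alpha eta yd x ->
  level_set rho x ->
  (lnorm 1 (x - xdag : ell2 R)%R
   <= (rho * (delta `^ q / (q * alpha)
              + c0_const omega xdag rho eta * delta
              + c0_const omega xdag rho eta `^ (q / (q - 1))
                * alpha `^ (q - 1)^-1))%:E)%E.
Proof.
move=> q1 r0 e0 a0 d0 yyd xmin xM.
have q0 : 0 < q by exact: lt_trans q1.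
apply: le_trans (variational_inequality e0 r0 xM) _.
rewrite lee_fin ler_pM2l//.
have [_ min_le] := minimizer_bound q1 a0 d0 yyd xmin.
set c0 := c0_const _ _ _ _; set t := `|A x - yd| in min_le *.
have c0_ge0 : 0 <= c0 by exact: c0_const_ge0.
have penalty_le : penalty eta x - penalty eta xdag <=
    delta `^ q / (q * alpha) - t `^ q / (q * alpha).
  rewrite -mulrBl ler_pdivlMr ?mulr_gt0// mulrC -mulrA -ler_pdivlMl//.
  by rewrite !mulrBr; lra.
have residual : c0 * `|A x - A xdag| <= c0 * t + c0 * delta.
  rewrite -mulrDr ler_wpM2l//; apply: le_trans (ler_distD yd _ _) _.
  by rewrite lerD2l distrC.
have := young_weighted q1 a0 c0_ge0 (normr_ge0 (A x - yd)); rewrite -/t.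
by lra.
Qed.

End ErrorEstimate.

(** The strict lower bound on rho leaves a gap rho^2 - r > 0, where r is the
value under the root. Dividing the minimality inequality by delta^(q-1), the
data error contributes delta / q only, which is below eta/2 times that gap for
small delta. *)
Lemma minimizer_level_set (R : realType) (Y : normedModType R)
    (A : {linear ell2 R -> Y}) (xdag : ell2 R) (q eta rho : R) :
  1 < q -> 0 < eta -> ell0 (xdag : nat -> R) ->
  Num.sqrt (2 / eta * fine (l0norm xdag) + `|xdag| ^+ 2) < rho ->
  \forall delta \near 0^'+, forall (yd : Y) (x : ell2 R),
    `|A xdag - yd| <= delta ->
    is_minimizer A q (delta `^ (q - 1)) eta yd x -> level_set rho x.
Proof.
move=> q1 e0 xdag0 sqrt_rho.
have q0 : 0 < q by exact: lt_trans q1.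
set r := 2 / eta * _ + _ in sqrt_rho.
have l0_ge0 (z : nat -> R) : 0 <= fine (l0norm z).
  by apply/fine_ge0/nneseries_ge0 => k _ _; rewrite lee_fin sgr_ge0.
have rho0 : 0 <= rho by exact: le_trans (sqrtr_ge0 _) (ltW sqrt_rho).
have r_ge0 : 0 <= r by rewrite addr_ge0 ?sqr_ge0// mulr_ge0// divr_ge0// ltW.
have r_rho : r < rho ^+ 2.
  by rewrite -(sqr_sqrtr r_ge0) ltr_pXn2r// nnegrE ?sqrtr_ge0.
near=> delta => yd x yyd xmin.
have d0 : 0 < delta by near: delta; exact: nbhs_right_gt.
have dsmall : delta < q * eta / 2 * (rho ^+ 2 - r).
  near: delta; apply: nbhs_right_lt.
  by rewrite mulr_gt0 ?subr_gt0// divr_gt0// mulr_gt0.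
have a0 : 0 < delta `^ (q - 1) by exact: powR_gt0.
have [x0 min_le] := minimizer_bound xdag0 q1 a0 d0 yyd xmin.
split=> //; rewrite -(@ler_pXn2r _ 2)// ?nnegrE//.
have : penalty eta x <= q^-1 * delta + penalty eta xdag.
  rewrite -(ler_pM2l a0); move: min_le; rewrite [delta `^ q]powR_mulr_pred//.
  have : 0 <= q^-1 * `|A x - yd| `^ q.
    by rewrite mulr_ge0 ?powR_ge0// invr_ge0 ltW.
  by lra.
have q_delta : q^-1 * delta < eta / 2 * (rho ^+ 2 - r).
  by rewrite mulrC ltr_pdivrMr//; move: dsmall; congr (_ < _); field.
rewrite /penalty => pen.
have rE : eta / 2 * r = fine (l0norm xdag) + eta / 2 * `|xdag| ^+ 2.
  by rewrite /r; field; rewrite gt_eqF.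
have e2 : 0 < eta / 2 by rewrite divr_gt0.
rewrite -(ler_pM2l e2); have := l0_ge0 x; rewrite mulrBr in q_delta; lra.
Unshelve. all: by end_near. Qed.

Theorem theorem3 (R : realType) (Y : completeNormedModType R)
    (hY : ~ finite_dimensional Y)
    (A : {linear ell2 R -> Y}) (As : dual Y -> ell2 R)
    (Abnd : bounded_near A (nbhs (0 : ell2 R)))
    (Ainj : injective A)
    (hAs : is_adjoint A As)
    (Arange : ~ closed (range A))
    (y : Y) (xdag : ell2 R)
    (hxdag : A xdag = y)
    (xdag0 : ell0 (xdag : nat -> R))
    (suppn0 : supp xdag !=set0)
    (omega : nat -> dual Y)
    (homega : forall i : nat, unit_seq i = As (omega i))
    (q : R) (q1 : 1 < q)
    (rho : R) (rho0 : 0 < rho) :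
  (forall (eta alpha delta : R) (yd : Y) (x : ell2 R),
     0 < eta -> 0 < alpha -> 0 < delta ->
     `|y - yd| <= delta ->
     is_minimizer A q alpha eta yd x ->
     level_set rho x ->
     (lnorm 1 (x - xdag : ell2 R)%R
      <= (rho * (delta `^ q / (q * alpha)
                 + c0_const omega xdag rho eta * delta
                 + c0_const omega xdag rho eta `^ (q / (q - 1))
                   * alpha `^ (q - 1)^-1))%:E)%E)
  /\
  (forall eta : R, 0 < eta ->
     Num.sqrt (2 / eta * fine (l0norm xdag) + `|xdag| ^+ 2) < rho ->
     \forall delta \near 0^'+, forall (yd : Y) (x : ell2 R),
       `|y - yd| <= delta ->
       is_minimizer A q (delta `^ (q - 1)) eta yd x ->
       (lnorm 1 (x - xdag : ell2 R)%R
        <= (rho * (q^-1 + c0_const omega xdag rho eta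
                   + c0_const omega xdag rho eta `^ (q / (q - 1)))
            * delta)%:E)%E).
Proof.
subst y; split=> [eta alpha delta yd x e0 a0 d0 yyd xmin xM|eta e0 sqrt_rho].
  exact: (error_estimate hAs homega xdag0 suppn0 q1 rho0 e0 a0 d0 yyd xmin xM).
have xMs := minimizer_level_set A q1 e0 xdag0 sqrt_rho.
apply: filterS2 xMs (nbhs_right_gt 0) => delta xM d0 yd x yyd xmin.
have a0 : 0 < delta `^ (q - 1) by exact: powR_gt0.
have q0 : 0 < q by exact: lt_trans q1.
have qm0 : 0 < q - 1 by rewrite subr_gt0.
apply: le_trans (error_estimate hAs homega xdag0 suppn0 q1 rho0 e0 a0 d0 yyd
  xmin (xM yd x yyd xmin)) _.
rewrite lee_fin le_eqVlt; apply/orP; left; apply/eqP.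
have -> : delta `^ q / (q * delta `^ (q - 1)) = q^-1 * delta.
  by rewrite [delta `^ q]powR_mulr_pred//; field; rewrite !gt_eqF.
rewrite -powRrM mulfV ?gt_eqF// powRr1 ?(ltW d0)//.
by ring.
Qed.
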